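(* Let $M=M_1^{a_1}\oplus\cdots\oplus M_n^{a_n}$ where $M_1,\dots,M_n$ are pairwise non-isomorphic finite indecomposable $R$-modules and $a_i\ge 1$, and let $\mathcal C=\langle M_1,\dots,M_n\rangle$ and $\mathcal C_{+1}$ be the associated categories. Let $V$ be an irreducible $K$-linear representation of $\mathrm{Aut}_R(M)$. Then there is a functor $F\in\mathcal C_{+1}$, unique up to isomorphism, such that $\mathrm{Hom}_{\mathrm{Aut}_R(M)}(KF(M),V)\neq 0$ and $\mathrm{Hom}_{\mathrm{Aut}_R(M)}(KG(M),V)=0$ for all $G\in\mathcal C_{+1}$ with $G\prec F$.
   Context: Let $\mathfrak o$ be a complete discrete valuation ring with uniformiser $\pi$ and finite residue field, $\ell\ge 1$, $\mathfrak o_\ell=\mathfrak o/\pi^\ell$. $R$ is a finite (not necessarily commutative) $\mathfrak o_\ell$-algebra, modules are left modules, and $K$ is an algebraically closed field of characteristic $0$. Representations are finite-dimensional over $K$. $\mathcal C=\langle M_1,\dots,M_n\rangle$ is the full subcategory of $R$-modules of the form $\bigoplus_i M_i^{b_i}$, $b_i\in\mathbb Z_{\ge0}$. $\mathcal C_{+1}$ is the (abelian) category of $\mathfrak o_\ell$-linear functors from $\mathcal C$ to finite $\mathfrak o_\ell$-modules, with kernels and cokernels computed pointwise. For $F\in\mathcal C_{+1}$ and $M\in\mathcal C$, $KF(M)$ is the $K$-vector space with basis $\{u_m\mid m\in F(M)\}$, a permutation representation of $\mathrm{Aut}_R(M)$ via functoriality: $g\cdot u_m=u_{F(g)(m)}$.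 For $F,G\in\mathcal C_{+1}$: $G\preccurlyeq F$ means $G$ is isomorphic to a subquotient of $F$; $G\prec F$ means $G\preccurlyeq F$ and $G\not\cong F$. *)

(* Defs.v *)
From HB Require Import structures.
From mathcomp Require Import all_boot all_order all_algebra all_fingroup.
From mathcomp Require Import generic_quotient ring_quotient mxrepresentation.
From mathcomp Require Import boolp.

Set Implicit Arguments.
Unset Strict Implicit.
Unset Printing Implicit Defensive.

Import GRing.Theory.
Local Open Scope ring_scope.

Section CompleteDVR.
Variable O : idomainType.

Definition divides (d x : O) : Prop := exists y, x = y * d.

Definition is_ideal (I : O -> Prop) : Prop :=
  [/\ I 0, forall x y, I x -> I y -> I (x + y) & forall a x, I x -> I (a * x)].

Definition is_prime_ideal (P : O -> Prop) : Prop :=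
  [/\ is_ideal P, ~ P 1 & forall x y, P (x * y) -> P x \/ P y].

(* A discrete valuation ring is a principal ideal domain with exactly one
   nonzero prime ideal; a uniformiser is a generator of that ideal. The
   topology is the pi-adic one; it is automatically separated. *)
Record complete_dvr (pi : O) : Prop := CompleteDVR {
  dvr_pid : forall I, is_ideal I -> exists d, forall x, I x <-> divides d x;
  dvr_pi_neq0 : pi != 0;
  dvr_pi_prime : is_prime_ideal (divides pi);
  dvr_prime_unique : forall P, is_prime_ideal P -> (exists2 x, P x & x != 0) ->
    forall x, P x <-> divides pi x;
  dvr_complete : forall u : nat -> O,
    (forall k, exists N, forall i j, (N <= i)%N -> (N <= j)%N ->
       divides (pi ^+ k) (u i - u j)) ->
    exists s, forall k, exists N, forall i, (N <= i)%N ->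
       divides (pi ^+ k) (u i - s);
  dvr_finite_residue : exists s : seq O, forall x,
    exists2 y, y \in s & divides pi (x - y)
}.

Variables (pi : O) (Opi : complete_dvr pi) (l : nat) (l_gt0 : (0 < l)%N).

Definition pow_ideal : {pred O} := fun x => `[< divides (pi ^+ l) x >].

Fact pow_ideal_closed : idealr_closed pow_ideal.
Proof.
split.
- by apply/asboolP; exists 0; rewrite mul0r.
- apply/asboolPn => -[y y1]; case: (dvr_pi_prime Opi) => _ + _; apply.
  by exists (y * pi ^+ l.-1); rewrite -mulrA -exprSr prednK.
- move=> a _ _ /asboolP[x ->] /asboolP[y ->]; apply/asboolP.
  by exists (a * x + y); rewrite mulrDl mulrA.
Qed.

Definition pow_idealr : idealr O :=
  HB.pack_for (idealr O) (pow_ideal : O -> bool)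
    (isIdealr.Build O pow_ideal pow_ideal_closed).

(* The quotient O / (pi ^ l). *)
Definition trunc_ring : comNzRingType := {ideal_quot pow_idealr}.

End CompleteDVR.

Arguments trunc_ring {O pi} Opi {l} l_gt0.

Section Modules.
Variable R : nzRingType.

Definition mod_iso (X Y : lmodType R) : Prop :=
  exists f : {linear X -> Y}, bijective f.

Definition indecomposable (X : lmodType R) : Prop :=
  (exists x : X, x != 0) /\
  forall Y Z : lmodType R, mod_iso X (Y * Z)%type ->
    (forall y : Y, y = 0) \/ (forall z : Z, z = 0).

Section DirectSum.
Variables (n : nat) (M_ : 'I_n -> finLmodType R).
Implicit Type b : 'I_n -> nat.

(* The direct sum of b i copies of M_ i, for i < n: the coordinate at the pair
   (i, k), k < b i, lies in M_ i. *)
Definition dsum b : Type :=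
  {dffun forall p : {i : 'I_n & 'I_(b i)}, M_ (tag p)}.

Variable b : 'I_n -> nat.
Implicit Types x y z : dsum b.

HB.instance Definition _ := Finite.on (dsum b).

Definition dsum_zero : dsum b := [ffun p => 0].
Definition dsum_opp x : dsum b := [ffun p => - x p].
Definition dsum_add x y : dsum b := [ffun p => x p + y p].
Definition dsum_scale (r : R) x : dsum b := [ffun p => r *: x p].

Fact dsum_addA : associative dsum_add.
Proof. by move=> x y z; apply/ffunP => p; rewrite !ffunE addrA. Qed.
Fact dsum_addC : commutative dsum_add.
Proof. by move=> x y; apply/ffunP => p; rewrite !ffunE addrC. Qed.
Fact dsum_add0 : left_id dsum_zero dsum_add.
Proof. by move=> x; apply/ffunP => p; rewrite !ffunE add0r. Qed.
Fact dsum_addN : left_inverse dsum_zero dsum_opp dsum_add.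
Proof. by move=> x; apply/ffunP => p; rewrite !ffunE addNr. Qed.

HB.instance Definition _ :=
  GRing.isZmodule.Build (dsum b) dsum_addA dsum_addC dsum_add0 dsum_addN.

Fact dsum_scaleA r s x : dsum_scale r (dsum_scale s x) = dsum_scale (r * s) x.
Proof. by apply/ffunP => p; rewrite !ffunE scalerA. Qed.
Fact dsum_scale1 : left_id 1 dsum_scale.
Proof. by move=> x; apply/ffunP => p; rewrite !ffunE scale1r. Qed.
Fact dsum_scaleDr : right_distributive dsum_scale +%R.
Proof. by move=> r x y; apply/ffunP => p; rewrite !ffunE scalerDr. Qed.
Fact dsum_scaleDl x : {morph dsum_scale^~ x : r s / r + s}.
Proof. by move=> r s; apply/ffunP => p; rewrite !ffunE scalerDl. Qed.

HB.instance Definition _ := GRing.Zmodule_isLmodule.Build R (dsum b)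
  dsum_scaleA dsum_scale1 dsum_scaleDr dsum_scaleDl.

End DirectSum.

Section Automorphisms.
Variable X : finLmodType R.

Definition mod_aut : {set {perm X}} :=
  [set g : {perm X} | `[< linear (g : X -> X) >]].

Fact mod_aut_group : group_set mod_aut.
Proof.
apply/group_setP; split=> [|g h].
  by rewrite inE; apply/asboolP => a x y; rewrite !perm1.
rewrite !inE => /asboolP glin /asboolP hlin.
by apply/asboolP => a x y; rewrite !permM glin hlin.
Qed.

Canonical mod_aut_groupType := Group mod_aut_group.

(* An element of mod_aut as a linear map (the identity outside mod_aut). *)
Definition aut_linear (g : {perm X}) : {linear X -> X} :=
  match pselect (linear (g : X -> X)) with
  | left glin => HB.pack_for {linear X -> X} (g : X -> X)
                   (GRing.isLinear.Build R X X *:%R g glin)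
  | right _ => idfun
  end.

Lemma aut_linearE g : g \in mod_aut -> aut_linear g =1 g.
Proof.
by rewrite inE => /asboolP glin x; rewrite /aut_linear; case: pselect.
Qed.

End Automorphisms.

End Modules.

Section Functors.
Variables (A : comNzRingType) (R : finAlgType A).
Variables (n : nat) (M_ : 'I_n -> finLmodType R).

(* The objects of the category <M_1, ..., M_n> are the modules dsum M_ b, so
   they are indexed by the multiplicities b. In lin_fmor, h is the map
   a f + g, where a acts through the structure morphism of the A-algebra R;
   taking a = 0 shows that fmor f depends only on the values of f. *)
Record lin_functor := LinFunctor {
  fobj :> ('I_n -> nat) -> finLmodType A;
  fmor : forall b c, {linear dsum M_ b -> dsum M_ c} -> {linear fobj b -> fobj c};
  fmor_id : forall b (x : fobj b), fmor (idfun : {linear dsum M_ b -> dsum M_ b}) x = x;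
  fmor_comp : forall b c d (f : {linear dsum M_ b -> dsum M_ c})
    (g : {linear dsum M_ c -> dsum M_ d}) (x : fobj b),
    fmor (g \o f : {linear dsum M_ b -> dsum M_ d}) x = fmor g (fmor f x);
  lin_fmor : forall b c (a : A) (f g h : {linear dsum M_ b -> dsum M_ c}),
    (forall x, h x = a%:A *: f x + g x) ->
    forall y : fobj b, fmor h y = a *: fmor f y + fmor g y
}.

Record nat_trans (F G : lin_functor) := NatTrans {
  component :> forall b, {linear F b -> G b};
  naturality : forall b c (f : {linear dsum M_ b -> dsum M_ c}) (x : F b),
    component c (fmor F f x) = fmor G f (component b x)
}.

Definition functor_iso (F G : lin_functor) : Prop :=
  exists eta : nat_trans F G, forall b, bijective (eta b).

(* As kernels and cokernels are computed pointwise, monomorphisms and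
   epimorphisms are the pointwise injective and surjective transformations:
   G is a quotient of a subobject H of F. *)
Definition subquotient (G F : lin_functor) : Prop :=
  exists (H : lin_functor) (i : nat_trans H F) (p : nat_trans H G),
    (forall b, injective (i b)) /\ (forall b (y : G b), exists x, p b x = y).

Definition strict_subquotient (G F : lin_functor) : Prop :=
  subquotient G F /\ ~ functor_iso G F.

End Functors.

Section Representations.

Definition rep_hom (K : fieldType) (gT : finGroupType) (G : {group gT}) n1 n2
    (rho1 : mx_representation K G n1) (rho2 : mx_representation K G n2)
    (B : 'M[K]_(n1, n2)) : Prop :=
  forall g, g \in G -> rho1 g *m B = B *m rho2 g.

Definition rep_hom_eq0 (K : fieldType) (gT : finGroupType) (G : {group gT})
    n1 n2 (rho1 : mx_representation K G n1) (rho2 : mx_representation K G n2) :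
    Prop :=
  forall B, rep_hom rho1 rho2 B -> B = 0.

Variables (K : fieldType) (A : comNzRingType) (R : finAlgType A).
Variables (n : nat) (M_ : 'I_n -> finLmodType R).
Variables (F : lin_functor M_) (b : 'I_n -> nat).

(* Matrices act on row vectors and the product g * h of permutations is
   "g, then h", so a matrix representation of mod_aut is a left representation
   of the automorphism group under composition. Row i is the image of the basis
   vector u_x, x = enum_val i: it is u_(F(g) x). *)
Definition KF_mx (g : {perm dsum M_ b}) : 'M[K]_#|F b| :=
  \matrix_(i, j) (fmor F (aut_linear g) (enum_val i) == enum_val j)%:R.

Lemma fmor_ext c d (f g : {linear dsum M_ c -> dsum M_ d}) :
  f =1 g -> fmor F f =1 fmor F g.
Proof.
move=> fg y; rewrite (@lin_fmor _ _ _ _ F _ _ 0 f g f) ?scale0r ?add0r //.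
by move=> x; rewrite !scale0r add0r fg.
Qed.

Fact KF_mx_repr : mx_repr (mod_aut (dsum M_ b)) KF_mx.
Proof.
split=> [|g h gA hA].
  apply/matrixP => i j; rewrite !mxE.
  rewrite (@fmor_ext _ _ _ (idfun : {linear dsum M_ b -> dsum M_ b})).
    by rewrite fmor_id (inj_eq enum_val_inj).
  by move=> x; rewrite aut_linearE ?group1 // perm1.
apply/matrixP => i j; rewrite !mxE.
rewrite (bigD1 (enum_rank (fmor F (aut_linear g) (enum_val i)))) //= !mxE.
rewrite enum_rankK eqxx mul1r big1 ?addr0 => [|k ki]; last first.
  rewrite !mxE; case: eqP => [e|]; last by rewrite mul0r.
  by case/eqP: ki; rewrite e enum_valK.
rewrite -fmor_comp; congr ((_ == _)%:R : K); apply: fmor_ext => x /=.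
by rewrite !aut_linearE ?groupM // permM.
Qed.

Definition KF : mx_representation K (mod_aut (dsum M_ b)) #|F b| :=
  MxRepresentation KF_mx_repr.

End Representations.

Arguments KF K {A R n M_} F b.

(* Main.v *)
Require Import Defs.
From HB Require Import structures.
From mathcomp Require Import all_boot all_order all_algebra all_fingroup.
From mathcomp Require Import mxrepresentation generic_quotient ring_quotient.
From mathcomp Require Import boolp.

(** Write [M] for [dsum M_ a], [E] for its endomorphism ring, [P] for the
    functor [Hom(M, -)], and say that [V] occurs in [F] when [Hom(KF(M), V)]
    is nonzero.

    Existence. [V] occurs in [P], because [P(M) = E] contains the regular
    permutation set of the automorphism group ([representable_hom]). Among
    the functors in which [V] occurs, choose [F] with [F(M)] of least
    cardinality. Every object of the category is a sum of summands of [M],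
    so a natural transformation bijective at [M] is an isomorphism
    ([nat_trans_bij]), and a strict subquotient of [F] takes a strictly
    smaller value at [M] ([strict_subquotient_card]).

    Uniqueness. It is enough that two functors [F], [G] in which [V] occurs
    have a common subquotient in which [V] occurs ([common_subquotient]): if
    [F] and [G] are minimal, this subquotient is isomorphic to both. The
    candidates come from Goursat's lemma. Elements [x] of [F(M)] and [y] of
    [G(M)] generate a subfunctor of [F x G], and it has a subquotient [Q = P
    / (ann x + ann y)] which is a subquotient of [F] and of [G]. Summing an
    equivariant map [f : G(M) -> V] over the fibres of the correspondence
    gives an equivariant map [Q(M) -> V], whose value at the class of the
    identity is the sum of [f] over the set [O(y) = {h y | h in E, h x = x}]
    ([push_id]).

    So fix a nonzero equivariant [f0 : F(M) -> V] and [x] with [f0 x]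
    nonzero; some [y] must have a nonzero sum over [O(y)]
    ([nonzero_orbit_sum]). Let [S] be the sum in [End(V)] of the
    automorphisms which fix [x]. If all the sums over the sets [O(y)]
    vanish, then [S] kills every [f y], by induction on the size of [O(y)]
    ([stab_sum_eq0]): the elements of [O(y)] which generate a smaller set
    contribute nothing once [S] is applied, and the others are images of [y]
    under automorphisms fixing [x]. As [V] is irreducible the vectors [f y]
    span it, so [S = 0]; but [S] multiplies [f0 x] by the order of the
    stabiliser, which is nonzero in characteristic zero.

    The fact about generators is Bass's lemma: elements of a finite
    [E]-module which generate the same submodule are in one orbit of the
    units of [E] ([unit_orbit]). It is proved by counting endomorphisms by
    their image. *)

Set Implicit Arguments.
Unset Strict Implicit.
Unset Printing Implicit Defensive.

Import GRing.Theory.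
Local Open Scope ring_scope.
Local Open Scope quotient_scope.

(** * Quotients of finite modules *)

Definition linear_pack (A : pzRingType) (X Y : lmodType A) (f : X -> Y)
    (f_lin : linear f) : {linear X -> Y} :=
  HB.pack_for {linear X -> Y} f (GRing.isLinear.Build A X Y *:%R f f_lin).

Definition submod_zmod (A : pzRingType) (X : lmodType A) (N : {pred X})
    (N_closed : submod_closed N) : zmodClosed X :=
  HB.pack_for (zmodClosed X) (N : X -> bool)
    (GRing.isZmodClosed.Build X N (GRing.submod_closedB N_closed)).

Section QuotientModule.
Variables (A : comNzRingType) (X : finLmodType A) (N : {pred X}).
Hypothesis N_closed : submod_closed N.

Definition lquot : Type := Quotient.quot (submod_zmod N_closed).

HB.instance Definition _ := Choice.on lquot.
HB.instance Definition _ := GRing.Zmodule.on lquot.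

Definition lproj (x : X) : lquot :=
  \pi_(Quotient.quot (submod_zmod N_closed)) x.
Definition lrepr (q : lquot) : X :=
  repr (q : Quotient.quot (submod_zmod N_closed)).

Lemma lreprK : cancel lrepr lproj. Proof. exact: reprK. Qed.

HB.instance Definition _ :=
  isCountable.Build lquot (pcan_pickleK (can_pcan lreprK)).
HB.instance Definition _ :=
  isFinite.Build lquot (pcan_enumP (can_pcan lreprK)).

Lemma lproj_eq x y : (lproj x = lproj y) <-> x - y \in N.
Proof.
rewrite -[x - y \in N]/(x - y \in submod_zmod N_closed) Quotient.idealrBE.
by split=> [/eqP|/eqP].
Qed.

Lemma lprojD x y : lproj (x + y) = lproj x + lproj y.
Proof. exact: (Quotient.pi_add (submod_zmod N_closed) x y). Qed.

Definition lquot_scale (a : A) (q : lquot) : lquot := lproj (a *: lrepr q).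

Lemma lprojZ a x : lproj (a *: x) = lquot_scale a (lproj x).
Proof.
apply/lproj_eq; rewrite -scalerBr; apply: (GRing.subsemimod_closedZ N_closed).
by apply/lproj_eq; rewrite lreprK.
Qed.

Fact lquot_scaleA a b q :
  lquot_scale a (lquot_scale b q) = lquot_scale (a * b) q.
Proof. by rewrite -[q]lreprK -!lprojZ scalerA. Qed.
Fact lquot_scale1 : left_id 1 lquot_scale.
Proof. by move=> q; rewrite -[q]lreprK -!lprojZ scale1r. Qed.
Fact lquot_scaleDr : right_distributive lquot_scale +%R.
Proof.
by move=> a p q; rewrite -[p]lreprK -[q]lreprK -lprojD -!lprojZ scalerDr lprojD.
Qed.
Fact lquot_scaleDl q : {morph lquot_scale^~ q : a b / a + b}.
Proof. by move=> a b; rewrite -[q]lreprK -!lprojZ scalerDl lprojD. Qed.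

HB.instance Definition _ := GRing.Zmodule_isLmodule.Build A lquot
  lquot_scaleA lquot_scale1 lquot_scaleDr lquot_scaleDl.

Fact lproj_linear : linear lproj.
Proof. by move=> a x y; rewrite lprojD lprojZ. Qed.
HB.instance Definition _ :=
  GRing.isLinear.Build A X lquot *:%R lproj lproj_linear.

Variables (Y : lmodType A) (f : {linear X -> Y}).
Hypothesis f0 : forall x, x \in N -> f x = 0.

Lemma lquot_lift_proj x : f (lrepr (lproj x)) = f x.
Proof.
by apply/eqP; rewrite -subr_eq0 -linearB f0 //; apply/lproj_eq; rewrite lreprK.
Qed.

Fact lquot_lift_linear : linear (f \o lrepr).
Proof.
move=> a p q; rewrite -[p]lreprK -[q]lreprK -linearP /=.
by rewrite !lquot_lift_proj linearP.
Qed.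

Definition lquot_lift : {linear lquot -> Y} := linear_pack lquot_lift_linear.

Lemma lquot_liftE x : lquot_lift (lproj x) = f x.
Proof. exact: lquot_lift_proj. Qed.
End QuotientModule.

(** * The module of linear maps *)

Section LinearMaps.
Variables (A : comNzRingType) (R : finAlgType A) (X Y : finLmodType R).

(** Finite functions make this a finite type. The scalars from [A] act through
    the centre of [R], so the linear maps form an [A]-module although [R] need
    not be commutative. *)
Definition linmap : Type := {f : {ffun X -> Y} | `[< linear f >]}.
HB.instance Definition _ := SubFinite.on linmap.

Definition linmap_lin (f : linmap) : {linear X -> Y} :=
  linear_pack (asboolW (svalP f)).
Coercion linmap_lin : linmap >-> GRing.Linear.type.

Fact to_linmap_subproof (f : {linear X -> Y}) : `[< linear [ffun x => f x] >].
Proof. by apply/asboolP => a x y; rewrite !ffunE linearP. Qed.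
Definition to_linmap (f : {linear X -> Y}) : linmap :=
  Sub [ffun x => f x] (to_linmap_subproof f).

Lemma to_linmapE f x : to_linmap f x = f x. Proof. exact: ffunE. Qed.

Lemma linmapP (f g : linmap) : f =1 g -> f = g.
Proof. by move=> fg; apply/val_inj/ffunP. Qed.

Fact linmap_add_linear (f g : linmap) : linear (fun x => f x + g x).
Proof. by move=> r x y; rewrite !linearP scalerDr addrACA. Qed.
Fact linmap_opp_linear (f : linmap) : linear (fun x => - f x).
Proof. by move=> r x y; rewrite linearP opprD scalerN. Qed.
Fact linmap_zero_linear : linear (fun _ : X => 0 : Y).
Proof. by move=> r x y; rewrite scaler0 addr0. Qed.
Fact linmap_scale_linear (a : A) (f : linmap) : linear (fun x => a%:A *: f x).
Proof.
move=> r x y; rewrite linearP scalerDr !scalerA.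
by rewrite mulr_algl mulr_algr.
Qed.

Definition linmap_zero := to_linmap (linear_pack linmap_zero_linear).
Definition linmap_opp f := to_linmap (linear_pack (linmap_opp_linear f)).
Definition linmap_add f g := to_linmap (linear_pack (linmap_add_linear f g)).
Definition linmap_scale a f :=
  to_linmap (linear_pack (linmap_scale_linear a f)).

Fact linmap_zeroE x : linmap_zero x = 0. Proof. exact: to_linmapE. Qed.
Fact linmap_oppE f x : linmap_opp f x = - f x. Proof. exact: to_linmapE. Qed.
Fact linmap_addE f g x : linmap_add f g x = f x + g x.
Proof. exact: to_linmapE. Qed.
Fact linmap_scaleE a f x : linmap_scale a f x = a%:A *: f x.
Proof. exact: to_linmapE. Qed.

Fact linmap_addA : associative linmap_add.
Proof. by move=> f g h; apply: linmapP => x; rewrite !linmap_addE addrA. Qed.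
Fact linmap_addC : commutative linmap_add.
Proof. by move=> f g; apply: linmapP => x; rewrite !linmap_addE addrC. Qed.
Fact linmap_add0 : left_id linmap_zero linmap_add.
Proof.
by move=> f; apply: linmapP => x; rewrite linmap_addE linmap_zeroE add0r.
Qed.
Fact linmap_addN : left_inverse linmap_zero linmap_opp linmap_add.
Proof.
move=> f; apply: linmapP => x.
by rewrite linmap_addE linmap_oppE linmap_zeroE addNr.
Qed.
HB.instance Definition _ :=
  GRing.isZmodule.Build linmap linmap_addA linmap_addC linmap_add0 linmap_addN.

Fact linmap_scaleA a b f :
  linmap_scale a (linmap_scale b f) = linmap_scale (a * b) f.
Proof.
by apply: linmapP => x; rewrite !linmap_scaleE scalerA mulr_algl scalerA.
Qed.
Fact linmap_scale1 : left_id 1 linmap_scale.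
Proof. by move=> f; apply: linmapP => x; rewrite linmap_scaleE !scale1r. Qed.
Fact linmap_scaleDr : right_distributive linmap_scale +%R.
Proof.
move=> a f g; apply: linmapP => x.
by rewrite linmap_addE !linmap_scaleE linmap_addE scalerDr.
Qed.
Fact linmap_scaleDl f : {morph linmap_scale^~ f : a b / a + b}.
Proof.
move=> a b; apply: linmapP => x.
by rewrite linmap_addE !linmap_scaleE -scalerDl -scalerDl.
Qed.
HB.instance Definition _ := GRing.Zmodule_isLmodule.Build A linmap
  linmap_scaleA linmap_scale1 linmap_scaleDr linmap_scaleDl.

Lemma linmapD (f g : linmap) x : (f + g : linmap) x = f x + g x.
Proof. exact: to_linmapE. Qed.
Lemma linmapZ a (f : linmap) x : (a *: f : linmap) x = a%:A *: f x.
Proof. exact: to_linmapE. Qed.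
End LinearMaps.

(** * Functors and representable functors *)

Section Functors.
Variables (A : comNzRingType) (R : finAlgType A).
Variables (n : nat) (M_ : 'I_n -> finLmodType R).
Implicit Types (b c : 'I_n -> nat) (F G H : lin_functor M_).

Definition nat_comp F G H (eta : nat_trans F G) (theta : nat_trans G H) :
  nat_trans F H.
Proof.
apply: (@NatTrans _ _ _ _ F H (fun b => theta b \o eta b)) => b c f x /=.
by rewrite !naturality.
Defined.

Section Inverse.
Variables (F G : lin_functor M_) (eta : nat_trans F G).
Variable inv : forall b, G b -> F b.
Arguments inv : clear implicits.
Hypotheses (etaK : forall b, cancel (eta b) (inv b))
           (invK : forall b, cancel (inv b) (eta b)).

Fact nat_inv_linear b : linear (inv b).
Proof.
by move=> r x y; apply: (can_inj (@etaK b)); rewrite linearP !invK.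
Qed.

Definition nat_inv : nat_trans G F.
Proof.
apply: (@NatTrans _ _ _ _ G F (fun b => linear_pack (@nat_inv_linear b))).
by move=> b c f x; apply: (can_inj (@etaK c)); rewrite naturality /= !invK.
Defined.
End Inverse.

Lemma functor_iso_sym F G : functor_iso F G -> functor_iso G F.
Proof.
case=> eta eta_bij.
have inverse b : exists g, cancel (eta b) g /\ cancel g (eta b).
  by case: (eta_bij b) => g; exists g.
pose inv b := sval (cid (inverse b)).
have etaK b : cancel (eta b) (inv b) by rewrite /inv; case: cid => g [].
have invK b : cancel (inv b) (eta b) by rewrite /inv; case: cid => g [].
exists (nat_inv etaK invK) => b; exists (eta b) => x.
  exact: invK.
exact: etaK.
Qed.

Lemma functor_iso_trans F G H :
  functor_iso F G -> functor_iso G H -> functor_iso F H.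
Proof.
case=> eta eta_bij [theta theta_bij].
by exists (nat_comp eta theta) => b; exact: bij_comp (theta_bij b) (eta_bij b).
Qed.

Section Representable.
Variable a : 'I_n -> nat.

Section Postcomposition.
Variables (b c : 'I_n -> nat) (f : {linear dsum M_ b -> dsum M_ c}).

Definition postcomp (h : linmap (dsum M_ a) (dsum M_ b)) :
    linmap (dsum M_ a) (dsum M_ c) :=
  to_linmap (f \o h).

Lemma postcompE h x : postcomp h x = f (h x). Proof. exact: to_linmapE. Qed.

Fact postcomp_linear : linear postcomp.
Proof.
move=> r g h; apply: linmapP => x.
by rewrite linmapD linmapZ !postcompE linmapD linmapZ linearP.
Qed.
End Postcomposition.

Definition representable : lin_functor M_.
Proof.
apply: (@LinFunctor _ _ _ _ (fun b => linmap (dsum M_ a) (dsum M_ b))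
  (fun b c f => linear_pack (@postcomp_linear b c f))).
- by move=> b h; apply: linmapP => x; rewrite postcompE.
- by move=> b c d f g h; apply: linmapP => x; rewrite !postcompE.
- move=> b c r f g h fgh y; apply: linmapP => x.
  by rewrite linmapD linmapZ !postcompE fgh.
Defined.

Lemma representableE b c (f : {linear dsum M_ b -> dsum M_ c})
    (h : representable b) x :
  (fmor representable f h : linmap _ _) x = f ((h : linmap _ _) x).
Proof. exact: postcompE. Qed.

(** By Yoneda's lemma the elements of [F a] are the transformations from
    [Hom(dsum M_ a, -)] to [F]; the image of the one given by [x] is the
    subfunctor generated by [x]. *)
Section Yoneda.
Variables (F : lin_functor M_) (x : F a).

Fact yoneda_linear b :
  linear (fun h : representable b => fmor F (h : linmap _ _) x).
Proof. by move=> r g h; apply: lin_fmor => y; rewrite linmapD linmapZ. Qed.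

Definition yoneda : nat_trans representable F.
Proof.
apply: (@NatTrans _ _ _ _ representable F
  (fun b => linear_pack (@yoneda_linear b))) => b c f h /=.
by rewrite -fmor_comp; apply: fmor_ext => y; exact: postcompE.
Defined.

Lemma yonedaE b (h : representable b) : yoneda b h = fmor F (h : linmap _ _) x.
Proof. by []. Qed.
End Yoneda.

End Representable.

(** * Quotient functors *)

Record subfunctor F := Subfunctor {
  sub_pred :> forall b, {pred F b};
  sub_closed : forall b, submod_closed (@sub_pred b);
  sub_fmor : forall b c (f : {linear dsum M_ b -> dsum M_ c}) x,
    x \in @sub_pred b -> fmor F f x \in @sub_pred c
}.

Definition kernel F G (eta : nat_trans F G) : subfunctor F.
Proof.
apply: (@Subfunctor F (fun b => [pred x | eta b x == 0])) => [b|b c f x].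
  split=> [|r x y]; rewrite !inE ?linear0 // => /eqP x0 /eqP y0.
  by rewrite linearP x0 y0 scaler0 addr0.
by rewrite !inE naturality => /eqP ->; rewrite linear0.
Defined.

Definition sub_sum F (N N' : subfunctor F) : subfunctor F.
Proof.
apply: (@Subfunctor F (fun b => [pred x | [exists y in N b, x - y \in N' b]])).
  move=> b; have [N0 NP] := sub_closed N b; have [N'0 N'P] := sub_closed N' b.
  split=> [|r x y]; rewrite !inE.
    by apply/exists_inP; exists 0; rewrite ?subr0.
  case/exists_inP=> x1 Nx1 N'x; case/exists_inP=> y1 Ny1 N'y.
  apply/exists_inP; exists (r *: x1 + y1); first exact: NP.
  by rewrite opprD addrACA -scalerBr; exact: N'P.
move=> b c f x; rewrite !inE => /exists_inP[y Ny N'x]; apply/exists_inP.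
by exists (fmor F f y); rewrite -?linearB; exact: sub_fmor.
Defined.

Section QuotientFunctor.
Variables (F : lin_functor M_) (N : subfunctor F).

Definition qobj b : finLmodType A := lquot (sub_closed N b).

Section Morphism.
Variables (b c : 'I_n -> nat) (f : {linear dsum M_ b -> dsum M_ c}).

Fact qmor_subproof x : x \in N b -> (lproj (sub_closed N c) \o fmor F f) x = 0.
Proof.
move=> Nx /=; rewrite -(linear0 (lproj (sub_closed N c))).
by apply/lproj_eq; rewrite subr0; exact: sub_fmor.
Qed.
Definition qmor : {linear qobj b -> qobj c} :=
  lquot_lift (sub_closed N b) qmor_subproof.

Lemma qmorE x : qmor (lproj _ x) = lproj _ (fmor F f x).
Proof. exact: lquot_liftE. Qed.
End Morphism.

Definition fquot : lin_functor M_.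
Proof.
apply: (@LinFunctor _ _ _ _ qobj qmor).
- by move=> b q; rewrite -[q]lreprK qmorE fmor_id.
- by move=> b c d f g q; rewrite -[q]lreprK !qmorE fmor_comp.
- move=> b c r f g h fgh q; rewrite -[q]lreprK !qmorE.
  by rewrite (lin_fmor fgh) linearP.
Defined.

Definition fquot_proj : nat_trans F fquot.
Proof.
apply: (@NatTrans _ _ _ _ F fquot (fun b => lproj (sub_closed N b))).
by move=> b c f x; symmetry; exact: qmorE.
Defined.

Lemma fquot_proj_eq b x y :
  fquot_proj b x = fquot_proj b y <-> x - y \in N b.
Proof. exact: lproj_eq. Qed.

Lemma fquot_proj_onto b (q : fquot b) : exists x, fquot_proj b x = q.
Proof. by exists (lrepr q); exact: lreprK. Qed.

Variables (G : lin_functor M_) (eta : nat_trans F G).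
Hypothesis eta0 : forall b x, x \in N b -> eta b x = 0.

Definition fquot_lift : nat_trans fquot G.
Proof.
apply: (@NatTrans _ _ _ _ fquot G
  (fun b => lquot_lift (sub_closed N b) (@eta0 b))).
move=> b c f q; have [x <-] := fquot_proj_onto q; rewrite -naturality.
transitivity (eta c (fmor F f x)); first exact: lquot_liftE.
by rewrite naturality; congr (fmor G f _); symmetry; exact: lquot_liftE.
Defined.

Lemma fquot_liftE b x : fquot_lift b (fquot_proj b x) = eta b x.
Proof. exact: lquot_liftE. Qed.
End QuotientFunctor.

(** [P / ker eta] is the image of [eta], a subobject of [F], and a larger
    subfunctor [N] gives a further quotient. Presenting images as quotients
    of [P] makes quotients the only construction needed for subquotients. *)
Lemma fquot_subquotient P F (eta : nat_trans P F) (N : subfunctor P) :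
  (forall b x, eta b x = 0 -> x \in N b) -> subquotient (fquot N) F.
Proof.
move=> kerN; exists (fquot (kernel eta)).
have k0 b x : x \in kernel eta b -> eta b x = 0 by rewrite inE => /eqP.
exists (fquot_lift k0).
have p0 b x : x \in kernel eta b -> fquot_proj N b x = 0.
  move/k0/kerN=> Nx; rewrite -(linear0 (fquot_proj N b)).
  by apply/fquot_proj_eq; rewrite subr0.
exists (fquot_lift p0); split=> b.
  move=> q q'; have [x <-] := fquot_proj_onto q.
  have [y <-] := fquot_proj_onto q'; rewrite !fquot_liftE => exy.
  by apply/fquot_proj_eq; rewrite inE linearB exy subrr.
move=> q; have [x <-] := fquot_proj_onto q.
by exists (fquot_proj (kernel eta) b x); rewrite fquot_liftE.
Qed.

End Functors.

(** * Functors are determined by one object *)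

Lemma inj_onto_bij (T U : Type) (f : T -> U) :
  injective f -> (forall y, exists x, f x = y) -> bijective f.
Proof.
move=> f_inj f_onto; pose g y := sval (cid (f_onto y)).
have gK : cancel g f by move=> y; rewrite /g; case: cid.
by exists g => // x; apply: f_inj; rewrite gK.
Qed.

Section Retract.
Variables (A : comNzRingType) (R : finAlgType A).
Variables (n : nat) (M_ : 'I_n -> finLmodType R).
Implicit Types (F G : lin_functor M_).

Lemma dsum_linE b (r : R) (x y : dsum M_ b) q :
  (r *: x + y : dsum M_ b) q = r *: x q + y q.
Proof. by rewrite !ffunE. Qed.

Section Coordinates.
Variables (b : 'I_n -> nat) (p : {i : 'I_n & 'I_(b i)}).

Definition coord (x : dsum M_ b) : M_ (tag p) := x p.
Definition inject (v : M_ (tag p)) : dsum M_ b :=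
  [ffun q => dfwith (T := fun q => M_ (tag q)) (fun=> 0) v q].

Fact coord_linear : linear coord.
Proof. by move=> r x y; exact: dsum_linE. Qed.

Lemma inject_in v : inject v p = v.
Proof. by rewrite ffunE dfwith_in. Qed.
Lemma inject_out v q : q != p -> inject v q = 0.
Proof. by move=> qp; rewrite ffunE dfwith_out // eq_sym. Qed.

Fact inject_linear : linear inject.
Proof.
move=> r v w; apply/ffunP => q; rewrite dsum_linE.
have [->|qp] := eqVneq q p; first by rewrite !inject_in.
by rewrite !inject_out // scaler0 addr0.
Qed.
End Coordinates.

Lemma sum_inject b (x : dsum M_ b) : \sum_p inject (coord p x) = x.
Proof.
apply/ffunP => q; have ev : {morph (fun y : dsum M_ b => y q) : y z / y + z}.
  by move=> y z; rewrite ffunE.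
rewrite (big_morph _ ev (ffunE _ q)) (bigD1 q) //= inject_in big1 ?addr0 //.
by move=> p pq; rewrite inject_out // eq_sym.
Qed.

Variables (a : 'I_n -> nat) (a_gt0 : forall i, (0 < a i)%N).

(** Every multiplicity [a i] is positive, so [dsum M_ a] has a coordinate in
    the same summand as [p]; maps between these two coordinates need no
    cast, since the first components agree definitionally. *)
Definition first_coord b (p : {i : 'I_n & 'I_(b i)}) : {i : 'I_n & 'I_(a i)} :=
  Tagged (fun i => 'I_(a i)) (Ordinal (a_gt0 (tag p))).

Definition to_first b p : {linear dsum M_ b -> dsum M_ a} :=
  (linear_pack (@inject_linear a (first_coord p))
     \o linear_pack (@coord_linear b p))%FUN.
Definition of_first b p : {linear dsum M_ a -> dsum M_ b} :=
  (linear_pack (@inject_linear b p)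
     \o linear_pack (@coord_linear a (first_coord p)))%FUN.

(** The identity of [dsum M_ b] is a sum of endomorphisms which factor through
    [dsum M_ a], one for each coordinate, and [F] is additive. *)
Lemma functor_split F b (x : F b) :
  x = \sum_p fmor F (of_first p) (fmor F (to_first p) x).
Proof.
pose t p : linmap (dsum M_ b) (dsum M_ b) :=
  to_linmap (of_first p \o to_first p).
have tE : to_linmap idfun = \sum_p t p.
  apply: linmapP => y; rewrite to_linmapE.
  have ev : {morph (fun f : linmap (dsum M_ b) (dsum M_ b) => f y)
               : f g / f + g}.
    by move=> f g; rewrite linmapD.
  have ev0 : (0 : linmap (dsum M_ b) (dsum M_ b)) y = 0 by exact: to_linmapE.
  rewrite (big_morph _ ev ev0) -[LHS]sum_inject.
  apply: eq_bigr => p _; rewrite /t to_linmapE /=; congr (inject _).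
  by rewrite /coord inject_in.
rewrite -[LHS]fmor_id (@fmor_ext _ _ _ _ F _ _ _ (to_linmap idfun)); last first.
  by move=> y; rewrite to_linmapE.
rewrite -[LHS]/(yoneda x b (to_linmap idfun)) tE linear_sum.
apply: eq_bigr => p _; rewrite yonedaE -fmor_comp; apply: fmor_ext => y.
exact: to_linmapE.
Qed.

(** Naturality and [functor_split] recover [eta b] from [eta a]; this is how the
    value at one object with all multiplicities positive controls a functor. *)
Lemma nat_trans_bij F G (eta : nat_trans F G) :
  bijective (eta a) -> forall b, bijective (eta b).
Proof.
case=> inv etaK invK b; apply: inj_onto_bij => [|y].
  apply: raddf_inj => x x0; rewrite (functor_split x) big1 // => p _.
  rewrite -[fmor F (to_first p) x]etaK naturality x0 linear0.
  by rewrite -(linear0 (eta a)) etaK linear0.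
exists (\sum_p fmor F (of_first p) (inv (fmor G (to_first p) y))).
rewrite linear_sum [RHS]functor_split; apply: eq_bigr => p _.
by rewrite naturality invK.
Qed.

(** If the cardinalities at [a] agreed, the inclusion and the projection which
    present [G] as a subquotient would both be bijective at [a], hence
    isomorphisms. *)
Lemma strict_subquotient_card F G :
  strict_subquotient G F -> (#|G a| < #|F a|)%N.
Proof.
case=> -[H [i [p [i_inj p_onto]]]] GF; rewrite ltnNge; apply/negP => FG.
have HF := leq_card (i a) (i_inj a).
pose s y := sval (cid (p_onto a y)).
have sK : cancel s (p a) by move=> y; rewrite /s; case: cid.
have s_inj := can_inj sK.
have i_bij b : bijective (i b).
  apply: nat_trans_bij b; apply: inj_card_bij; first exact: i_inj.
  exact: leq_trans FG (leq_card s s_inj).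
have p_bij b : bijective (p b).
  apply: nat_trans_bij b; apply: bij_can_bij sK.
  exact: inj_card_bij s_inj (leq_trans HF FG).
apply: GF; apply: (@functor_iso_trans _ _ _ _ _ H); last by exists i.
by apply: functor_iso_sym; exists p.
Qed.
End Retract.

(** * Generators of a finite module over an endomorphism ring *)

Section UnitOrbits.
Variables (A : comNzRingType) (R : finAlgType A) (X : finLmodType R).
Variables (Z : finZmodType) (act : linmap X X -> Z -> Z).
Hypothesis act1 : forall z, act (to_linmap idfun) z = z.
Hypothesis actM : forall (f g : linmap X X) z,
  act (to_linmap (f \o g)) z = act f (act g z).
Hypothesis actD : forall (f g : linmap X X) z,
  act (f + g) z = act f z + act g z.
Implicit Types (L : {set X}) (f g h : linmap X X) (z w : Z).

(** [into L] is a right ideal of the endomorphism ring when [L] is a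
    submodule; it plays the role of [Hom(X, L)]. *)
Definition into L := [set f : linmap X X | f @: [set: X] \subset L].
Definition fiber L z w := [set f in into L | act f z == w].
Definition onto_fiber L z w :=
  [set f : linmap X X | (f @: [set: X] == L) && (act f z == w)].

Lemma intoP L f : reflect (forall x, f x \in L) (f \in into L).
Proof.
rewrite inE; apply: (iffP subsetP) => [fL x | fL _ /imsetP[x _ ->]] //.
by apply: fL; rewrite imset_f.
Qed.

Lemma act0 z : act 0 z = 0.
Proof. by apply: (addrI (act 0 z)); rewrite -actD !addr0. Qed.

Lemma actB f g z : act (f - g) z = act f z - act g z.
Proof. by apply: (addIr (act g z)); rewrite -actD !subrK. Qed.

Section Additive.
Variable L : {set X}.
Hypothesis L_closed : zmod_closed L.

Lemma into0 : 0 \in into L.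
Proof. by apply/intoP => x; rewrite to_linmapE; case: L_closed. Qed.

Lemma intoB f g : f \in into L -> g \in into L -> f - g \in into L.
Proof.
move=> /intoP fL /intoP gL; apply/intoP => x; rewrite linmapD.
have -> : (- g : linmap X X) x = - g x by exact: to_linmapE.
by case: L_closed => _; apply.
Qed.

Lemma intoD f g : f \in into L -> g \in into L -> f + g \in into L.
Proof.
move=> fL gL; rewrite -[g]opprK -[- g]sub0r.
exact: intoB fL (intoB into0 gL).
Qed.

Lemma card_fiber z w f : f \in fiber L z w -> #|fiber L z w| = #|fiber L z 0|.
Proof.
rewrite inE => /andP[fL /eqP fz].
rewrite -(card_imset _ (addIr (- f))); apply: eq_card => g.
apply/imsetP/idP => [[h + ->]|].
  rewrite inE => /andP[hL /eqP hz].
  by rewrite inE actB hz fz subrr eqxx andbT intoB.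
rewrite inE => /andP[gL /eqP gz]; exists (g + f); last by rewrite addrK.
by rewrite inE intoD //= actD gz fz add0r.
Qed.

(** Evaluation at [z] is additive, so its fibres on [into L] are cosets of
    [fiber L z 0]. *)
Lemma card_into z :
  #|into L| = muln #|[set act f z | f in into L]| #|fiber L z 0|.
Proof.
rewrite -sum1_card (partition_big_imset (act^~ z)) /= -sum_nat_const.
apply: eq_bigr => _ /imsetP[f fL ->].
have /card_fiber <- : f \in fiber L z (act f z) by rewrite inE fL /=.
by rewrite -sum1_card; apply: eq_bigl => g; rewrite [in RHS]inE.
Qed.

(** [into L] absorbs multiplication on the right, so that
    [I z = I (g w)] is contained in [I w] for [I = into L], and conversely. *)
Lemma into_orbit f g z w : act f z = w -> act g w = z ->
  [set act h z | h in into L] = [set act h w | h in into L].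
Proof.
move=> fz gw; apply/eqP; rewrite eqEsubset; apply/andP; split.
all: apply/subsetP => _ /imsetP[h /intoP hL ->].
  by rewrite -gw -actM imset_f //; apply/intoP => x; rewrite to_linmapE hL.
by rewrite -fz -actM imset_f //; apply/intoP => x; rewrite to_linmapE hL.
Qed.

(** The two evaluation maps on [into L], at [z] and at [w], have the same
    image, hence kernels of the same size; and [w] lies in one image if and
    only if it lies in the other. *)
Lemma card_fiber_eq f g z w : act f z = w -> act g w = z ->
  #|fiber L z w| = #|fiber L w w|.
Proof.
move=> fz gw; have orb := into_orbit fz gw.
have ker : #|fiber L z 0| = #|fiber L w 0|.
  have := card_into z; rewrite (card_into w) orb => /eqP.
  rewrite eqn_pmul2l => [/eqP -> //|]; apply/card_gt0P; exists (act 0 z).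
  by rewrite -orb imset_f // into0.
have in_orbit v : (w \in [set act h v | h in into L]) = (0 < #|fiber L v w|)%N.
  apply/imsetP/card_gt0P => [[h hL ->]|[h]].
    by exists h; rewrite inE hL /=.
  by rewrite inE => /andP[hL /eqP <-]; exists h.
have := in_orbit z; rewrite orb in_orbit.
case: (posnP #|fiber L z w|) => [-> | hz].
  by move/negbT; rewrite -eqn0Ngt => /eqP.
case/card_gt0P: hz => h hz /card_gt0P[k kw].
by rewrite (card_fiber hz) (card_fiber kw).
Qed.
End Additive.

Lemma image_closed f : zmod_closed (f @: [set: X]).
Proof.
split=> [|_ _ /imsetP[x _ ->] /imsetP[y _ ->]].
  by apply/imsetP; exists 0; rewrite ?linear0.
by rewrite -linearB imset_f.
Qed.

Lemma card_fiberE L z w :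
  #|fiber L z w| = (\sum_(L' : {set X} | L' \subset L) #|onto_fiber L' z w|)%N.
Proof.
rewrite -sum1_card (partition_big (fun f : linmap X X => f @: [set: X])
  (fun L' => L' \subset L)) /=; last by move=> f; rewrite !inE => /andP[].
apply: eq_bigr => L' L'L; rewrite -sum1_card; apply: eq_bigl => f.
by rewrite !inE andbC; case: eqP => //= ->; rewrite L'L.
Qed.

(** Inclusion-exclusion over the submodules of [L] turns the equality for
    maps into [L] into the equality for maps onto [L]. *)
Lemma card_onto_fiber_eq f g z w : act f z = w -> act g w = z ->
  forall L, #|onto_fiber L z w| = #|onto_fiber L w w|.
Proof.
move=> fz gw L; have [k] := ubnP #|L|; elim: k L => // k IHk L /ltnSE-Lk.
(* When [L] is not the image of an endomorphism, both sides count nothing. *)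
have [hL | noL] := pselect (exists h, h @: [set: X] = L); last first.
  have none v : #|onto_fiber L v w| = 0%N; last by rewrite !none.
  apply: eq_card0 => h; rewrite !inE; apply/andP => -[/eqP hL _].
  by apply: noL; exists h.
have L_closed : zmod_closed L by case: hL => h <-; exact: image_closed.
have := card_fiber_eq L_closed fz gw; rewrite !card_fiberE.
rewrite !(bigD1 L (P := fun L' => L' \subset L)) //= => /eqP.
rewrite (eq_bigr (fun L' => #|onto_fiber L' w w|)) ?eqn_add2r => [/eqP //|].
move=> L' /andP[L'L neqL]; apply: IHk; apply: leq_trans Lk.
by apply: proper_card; rewrite properEneq neqL.
Qed.

(** The identity is onto and fixes [w], so by [card_onto_fiber_eq] some
    endomorphism which is onto maps [z] to [w]; on a finite module it is
    bijective. *)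
Lemma unit_orbit f g z w : act f z = w -> act g w = z ->
  exists2 h : linmap X X, bijective h & act h z = w.
Proof.
move=> fz gw.
have : (0 < #|onto_fiber setT w w|)%N.
  apply/card_gt0P; exists (to_linmap idfun); rewrite inE act1 eqxx andbT.
  apply/eqP/setP => x; rewrite inE; apply/imsetP.
  by exists x; rewrite ?to_linmapE.
rewrite -(card_onto_fiber_eq fz gw) => /card_gt0P[h0].
pose h : linmap X X := h0.
rewrite -/h inE => /andP[/eqP h_onto /eqP hz]; exists h => //.
have /imset_injP h_inj : #|h @: [set: X]| == #|[set: X]| by rewrite h_onto.
by apply: injF_bij => x y; apply: h_inj; rewrite inE.
Qed.

End UnitOrbits.

(** * Equivariant functions *)

Definition prod_finZmod (X Y : finZmodType) : finZmodType :=
  HB.pack_for finZmodType (X * Y)%type.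

Section Permutation.
Variables (A : comNzRingType) (R : finAlgType A).
Variables (n : nat) (M_ : 'I_n -> finLmodType R) (a : 'I_n -> nat).
Implicit Types (F G : lin_functor M_).
Local Notation gT := {perm dsum M_ a}.
Local Notation aut := (mod_aut (dsum M_ a)).
Local Notation endo := (linmap (dsum M_ a) (dsum M_ a)).
Implicit Types (g k : gT) (h : endo).

Lemma bij_aut h : bijective h -> exists2 g, g \in aut & aut_linear g =1 h.
Proof.
move/bij_inj=> h_inj; have gA : perm h_inj \in aut.
  by rewrite inE; apply/asboolP => r x y; rewrite !permE linearP.
by exists (perm h_inj) => // x; rewrite aut_linearE // permE.
Qed.

Lemma fmor_aut1 F (x : F a) : fmor F (aut_linear (1%g : gT)) x = x.
Proof.
rewrite -[RHS]fmor_id; apply: fmor_ext => y.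
by rewrite aut_linearE ?group1 // perm1.
Qed.

Lemma fmor_autM F g k (x : F a) : g \in aut -> k \in aut ->
  fmor F (aut_linear (g * k)%g) x =
    fmor F (aut_linear k) (fmor F (aut_linear g) x).
Proof.
move=> gA kA; rewrite -fmor_comp; apply: fmor_ext => y /=.
by rewrite !aut_linearE ?groupM // permM.
Qed.

Lemma fmor_autK F g : g \in aut ->
  cancel (fmor F (aut_linear g)) (fmor F (aut_linear g^-1%g)).
Proof. by move=> gA x; rewrite -fmor_autM ?groupV // mulgV fmor_aut1. Qed.

(** Applying [unit_orbit] to the product module [F a * G a], rather than to each
    factor, gives one automorphism which works for both elements. *)
Lemma pair_orbit F G (x x' : F a) (y y' : G a) h h' :
  fmor F h x = x' -> fmor G h y = y' -> fmor F h' x' = x -> fmor G h' y' = y ->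
  exists g, [/\ g \in aut, fmor F (aut_linear g) x = x'
                         & fmor G (aut_linear g) y = y'].
Proof.
move=> hx hy hx' hy'.
pose Z := prod_finZmod (F a) (G a).
pose act (f : endo) (z : Z) : Z := (fmor F f z.1, fmor G f z.2).
have act1 z : act (to_linmap idfun) z = z.
  case: z => u v; rewrite /act /=; congr (_, _); rewrite -[RHS]fmor_id.
    by apply: fmor_ext => w; rewrite to_linmapE.
  by apply: fmor_ext => w; rewrite to_linmapE.
have actM (f g : endo) z : act (to_linmap (f \o g)) z = act f (act g z).
  rewrite /act /=; congr (_, _); rewrite -fmor_comp.
    by apply: fmor_ext => w; rewrite to_linmapE.
  by apply: fmor_ext => w; rewrite to_linmapE.
have actD (f g : endo) z : act (f + g) z = act f z + act g z.
  have fgE w : (f + g : endo) w = 1%:A *: f w + g w.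
    by rewrite linmapD !scale1r.
  by rewrite /act !(lin_fmor fgE) !scale1r.
have [] := @unit_orbit _ _ _ Z act act1 actM actD h h' (x, y) (x', y').
- by rewrite /act /= hx hy.
- by rewrite /act /= hx' hy'.
move=> u /bij_aut[g gA gu] [ux uy]; exists g.
by split=> //; [rewrite -ux | rewrite -uy]; apply: fmor_ext.
Qed.

Variables (K : fieldType) (m : nat) (V : mx_representation K aut m).

Definition equivariant F (f : F a -> 'rV[K]_m) :=
  forall g, g \in aut -> forall x, f (fmor F (aut_linear g) x) = f x *m V g.

Lemma row_KF F g (x : F a) :
  row (enum_rank x) (KF K F a g) =
    delta_mx 0 (enum_rank (fmor F (aut_linear g) x)).
Proof.
apply/rowP => j; rewrite !mxE enum_rankK /= eq_sym.
by congr (_%:R); rewrite -(inj_eq enum_val_inj) enum_rankK.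
Qed.

(** [KF K F a] has the elements of [F a] as a basis, so a homomorphism from
    it is determined by an arbitrary equivariant function on [F a]. *)
Lemma rep_hom_neq0P F :
  ~ rep_hom_eq0 (KF K F a) V <->
  exists f : F a -> 'rV[K]_m, equivariant f /\ exists x, f x != 0.
Proof.
split=> [/existsNP[B /not_implyP[BV /eqP B0]] | [f [fV [x fx0]]] eq0].
  exists (fun x => row (enum_rank x) B); split=> [g gA x|].
    by rewrite -row_mul -BV // row_mul row_KF -rowE.
  apply: contrapT => /forallNP rows0; case/eqP: B0; apply/row_matrixP => i.
  by rewrite row0 -[i]enum_valK; apply/eqP/negPn/negP/rows0.
pose B := \matrix_(i < #|F a|) f (enum_val i).
have rowB y : row (enum_rank y) B = f y by rewrite rowK enum_rankK.
case/eqP: fx0; rewrite -rowB (eq0 B) ?row0 // => g gA.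
apply/row_matrixP => i; rewrite -[i]enum_valK !row_mul row_KF -rowE.
by rewrite !rowB fV.
Qed.

End Permutation.

(** * Sums over endomorphism orbits *)

Section Stabiliser.
Variables (A : comNzRingType) (R : finAlgType A).
Variables (n : nat) (M_ : 'I_n -> finLmodType R) (a : 'I_n -> nat).
Variables (K : fieldType) (K_char0 : [pchar K] =i pred0).
Variables (m : nat) (V : mx_representation K (mod_aut (dsum M_ a)) m).
Variables (F G : lin_functor M_) (x0 : F a).
Local Notation aut := (mod_aut (dsum M_ a)).
Local Notation endo := (linmap (dsum M_ a) (dsum M_ a)).

Definition stab := [set g in aut | fmor F (aut_linear g) x0 == x0].
Definition stab_sum : 'M[K]_m := \sum_(g in stab) V g.

(** The orbit of [y] under the monoid of the endomorphisms of [dsum M_ a] which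
    fix [x0], as opposed to the group [stab] of the automorphisms which do. *)
Definition end_orbit (y : G a) : {set G a} :=
  [set fmor G (h : endo) y | h : endo & fmor F (h : endo) x0 == x0].

Lemma natr_neq0 k : (0 < k)%N -> k%:R != 0 :> K.
Proof. by move/pcharf0P: K_char0 => ->; rewrite -lt0n. Qed.

Lemma stab_sum_mull g : g \in stab -> V g *m stab_sum = stab_sum.
Proof.
case/setIdP=> gA /eqP gx.
rewrite mulmx_sumr /stab_sum [RHS](reindex_inj (mulgI g)) /=.
apply: eq_big => [k | k /setIdP[kA _]]; last by rewrite repr_mxM.
apply/setIdP/setIdP => -[kA]; rewrite groupMl // in kA *.
  by rewrite fmor_autM // gx.
by rewrite fmor_autM // gx.
Qed.

Lemma end_orbit_refl y : y \in end_orbit y.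
Proof.
apply/imsetP; exists (to_linmap idfun).
  rewrite inE -[X in _ == X]fmor_id; apply/eqP; apply: fmor_ext => w.
  exact: to_linmapE.
by rewrite -[LHS]fmor_id; apply: fmor_ext => w; rewrite to_linmapE.
Qed.

Lemma end_orbit_trans y y' :
  y' \in end_orbit y -> end_orbit y' \subset end_orbit y.
Proof.
have comp (F' : lin_functor M_) (k h : endo) (z : F' a) :
    fmor F' (to_linmap (k \o h) : endo) z = fmor F' k (fmor F' h z).
  by rewrite -fmor_comp; apply: fmor_ext => w; rewrite to_linmapE.
case/imsetP=> h; rewrite inE => /eqP hx ->.
apply/subsetP => _ /imsetP[k + ->]; rewrite inE => /eqP kx.
rewrite -comp; apply/imsetP.
exists (to_linmap ((k : endo) \o (h : endo))) => //.
by rewrite inE comp hx kx.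
Qed.

(** The sum over an endomorphism orbit splits into the elements which
    generate the same orbit and those which generate a smaller one. After
    multiplication by [stab_sum] the latter vanish by induction, while each
    of the former contributes [f y *m stab_sum], so a positive multiple of
    this vector is zero. *)
Lemma stab_sum_eq0 (f : G a -> 'rV[K]_m) : equivariant V f ->
  (forall y, \sum_(z in end_orbit y) f z = 0) ->
  forall y, f y *m stab_sum = 0.
Proof.
move=> fV f0 y; have [k] := ubnP #|end_orbit y|.
elim: k y => // k IHk y /ltnSE-yk.
have := congr1 (mulmx^~ stab_sum) (f0 y); rewrite /= mul0mx mulmx_suml.
rewrite (bigID (fun z => y \in end_orbit z)) /= addrC big1 ?add0r; last first.
  (* [z] does not generate [y], so its orbit is smaller. *)
  move=> z /andP[yz zy]; apply: IHk; apply: leq_trans yk; apply: proper_card.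
  rewrite properE end_orbit_trans //=; apply: contra zy => /subsetP; apply.
  exact: end_orbit_refl.
rewrite (eq_bigr (fun=> f y *m stab_sum)) => [|z /andP[yz zy]]; last first.
  (* [z] generates [y] back, so an automorphism fixing [x0] maps [y] to [z]. *)
  have [h /[!inE]/eqP hx hy] := imsetP yz.
  have [h' /[!inE]/eqP hx' hy'] := imsetP zy.
  have [g [gA gx gy]] := pair_orbit hx (esym hy) hx' (esym hy').
  rewrite -gy fV // -mulmxA stab_sum_mull //.
  by rewrite inE gA gx eqxx.
rewrite sumr_const => /eqP; rewrite -scaler_nat scaler_eq0 => /orP[|/eqP //].
rewrite (negPf (natr_neq0 _)) //; apply/card_gt0P; exists y.
by rewrite unfold_in /= end_orbit_refl.
Qed.

Lemma stab_sum_fixed (f : F a -> 'rV[K]_m) : equivariant V f ->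
  f x0 *m stab_sum = #|stab|%:R *: f x0.
Proof.
move=> fV; rewrite mulmx_sumr (eq_bigr (fun=> f x0)) ?sumr_const ?scaler_nat //.
by move=> g /setIdP[gA /eqP gx]; rewrite -fV // gx.
Qed.

(** By equivariance the values of [f] span an invariant subspace. *)
Lemma equivariant_span (f : G a -> 'rV[K]_m) : mx_irreducible V ->
  equivariant V f -> (exists y, f y != 0) ->
  forall v : 'rV[K]_m, (v <= \matrix_(i < #|G a|) f (enum_val i))%MS.
Proof.
case=> _ _ V_simple fV [y fy0] v; set B := \matrix_(i < _) _.
have rowB z : row (enum_rank z) B = f z by rewrite rowK enum_rankK.
rewrite -(genmxE B); apply: submx_trans (submx1 v) _.
apply: V_simple (submx1 _) _.
  apply/mxmoduleP => g gA; rewrite (eqmxMr _ (genmxE B)) genmxE.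
  apply/row_subP => i; rewrite -[i]enum_valK row_mul rowB -fV // -rowB.
  exact: row_sub.
apply: contraNneq fy0 => B0; rewrite -rowB -submx0.
by apply: submx_trans (row_sub _ _) _; rewrite -(genmxE B) B0.
Qed.

(** Otherwise [stab_sum] kills the values of [f'], which span [V], whereas it
    multiplies [f x0] by the order of [stab]. *)
Lemma nonzero_orbit_sum (f : F a -> 'rV[K]_m) (f' : G a -> 'rV[K]_m) :
  mx_irreducible V -> equivariant V f -> f x0 != 0 ->
  equivariant V f' -> (exists y, f' y != 0) ->
  exists y, \sum_(z in end_orbit y) f' z != 0.
Proof.
move=> V_irr fV fx0 f'V f'0; apply: contrapT => /forallNP no_y.
have kills := stab_sum_eq0 f'V
  (fun y => contrapT (fun h => no_y y (introN eqP h))).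
have /submxP[D fD] := equivariant_span V_irr f'V f'0 (f x0).
have := stab_sum_fixed fV; rewrite fD -mulmxA.
have -> : (\matrix_(i < #|G a|) f' (enum_val i)) *m stab_sum = 0.
  by apply/row_matrixP => i; rewrite row_mul rowK kills row0.
rewrite mulmx0 => /esym/eqP; rewrite -fD scaler_eq0 (negPf fx0) orbF.
apply/negP/natr_neq0/card_gt0P; exists 1%g.
by rewrite inE group1 fmor_aut1 eqxx.
Qed.

End Stabiliser.

(** * The Goursat subquotient *)

Section Correspondence.
Variables (A : comNzRingType) (R : finAlgType A).
Variables (n : nat) (M_ : 'I_n -> finLmodType R) (a : 'I_n -> nat).
Variables (K : fieldType) (m : nat).
Variable V : mx_representation K (mod_aut (dsum M_ a)) m.
Variables (F G : lin_functor M_) (x : F a) (y : G a).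
Local Notation aut := (mod_aut (dsum M_ a)).
Local Notation endo := (linmap (dsum M_ a) (dsum M_ a)).

(** For [P = Hom(dsum M_ a, -)], the sum of the annihilators of [x] and [y].
    The quotient of [P] by it is the common subquotient which Goursat's
    lemma attaches to the subfunctor of [F x G] generated by [(x, y)]. *)
Definition goursat_sub : subfunctor (representable M_ a) :=
  sub_sum (kernel (yoneda x)) (kernel (yoneda y)).
Definition goursat : lin_functor M_ := fquot goursat_sub.

Lemma goursat_subP b (h : linmap (dsum M_ a) (dsum M_ b)) :
  h \in goursat_sub b <->
  exists u, fmor F (u : linmap (dsum M_ a) (dsum M_ b)) x = 0 /\
    fmor G u y = fmor G h y.
Proof.
split=> [/exists_inP[u] | [u [ux uy]]].
  rewrite !inE linearB subr_eq0 => /eqP ux /eqP uy; exists u; split=> //.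
apply/exists_inP; exists u; rewrite inE; first exact/eqP.
by rewrite linearB subr_eq0 !yonedaE uy.
Qed.

Lemma goursat_left : subquotient goursat F.
Proof.
apply: (fquot_subquotient (eta := yoneda x)) => b h hx.
by apply/goursat_subP; exists h.
Qed.

Lemma goursat_right : subquotient goursat G.
Proof.
apply: (fquot_subquotient (eta := yoneda y)) => b h hy.
by apply/goursat_subP; exists 0; rewrite -!yonedaE !linear0 hy.
Qed.

Variable f : G a -> 'rV[K]_m.
Hypothesis fV : equivariant V f.

(** The graph of the correspondence from [goursat] to [G] induced by the
    subfunctor of [F x G] generated by [(x, y)]. *)
Definition goursat_fiber (q : goursat a) : {set G a} :=
  [set fmor G (h : endo) y | h : endo & fquot_proj goursat_sub a h == q].

Definition push (q : goursat a) : 'rV[K]_m := \sum_(z in goursat_fiber q) f z.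

Lemma goursat_fiber_aut g q z : g \in aut -> z \in goursat_fiber q ->
  fmor G (aut_linear g) z \in goursat_fiber (fmor goursat (aut_linear g) q).
Proof.
move=> gA /imsetP[h + ->]; rewrite inE => /eqP <-.
apply/imsetP; exists (postcomp (aut_linear g) h).
  by rewrite inE naturality.
by rewrite -!yonedaE -naturality.
Qed.

Lemma push_equivariant : equivariant V push.
Proof.
move=> g gA q; rewrite mulmx_suml /push.
rewrite (reindex_inj (can_inj (fmor_autK (F := G) gA))).
apply: eq_big => [z | z _]; last exact: fV.
apply/idP/idP => [|zq]; last exact: goursat_fiber_aut.
by move/(goursat_fiber_aut (groupVr gA)); rewrite !fmor_autK.
Qed.

(** If [h - 1] is in [ann x + ann y], then correcting [h] by an element of
    [ann y] gives an endomorphism which fixes [x] and has the same value at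
    [y]. *)
Lemma goursat_fiber_id :
  goursat_fiber (fquot_proj goursat_sub a (to_linmap idfun)) = end_orbit x y.
Proof.
have id_act (H : lin_functor M_) (z : H a) :
    fmor H (to_linmap idfun : endo) z = z.
  by rewrite -[RHS]fmor_id; apply: fmor_ext => w; rewrite to_linmapE.
apply/setP => z; apply/imsetP/imsetP => -[h].
  rewrite inE => /eqP/fquot_proj_eq/goursat_subP[u [ux uy]] ->.
  exists (u + to_linmap idfun : endo).
    by rewrite inE -yonedaE linearD !yonedaE ux id_act add0r.
  by rewrite -!yonedaE linearD !yonedaE uy -!yonedaE -linearD subrK.
rewrite inE => /eqP hx ->; exists h => //; rewrite inE.
apply/eqP/fquot_proj_eq/goursat_subP; exists (h - to_linmap idfun).
by rewrite -!yonedaE linearB !yonedaE hx id_act subrr.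
Qed.

Lemma push_id :
  push (fquot_proj goursat_sub a (to_linmap idfun)) =
    \sum_(z in end_orbit x y) f z.
Proof. by rewrite /push goursat_fiber_id. Qed.

End Correspondence.

(** * Minimal functors *)

Section Minimal.
Variables (A : comNzRingType) (R : finAlgType A).
Variables (n : nat) (M_ : 'I_n -> finLmodType R) (a : 'I_n -> nat).
Variables (K : fieldType) (K_char0 : [pchar K] =i pred0) (m : nat).
Variable V : mx_representation K (mod_aut (dsum M_ a)) m.
Hypothesis V_irr : mx_irreducible V.
Implicit Types F G Q : lin_functor M_.
Local Notation aut := (mod_aut (dsum M_ a)).

(** [nonzero_orbit_sum] provides [x] and [y] for which [push] is nonzero at the
    class of the identity. *)
Lemma common_subquotient F G :
  ~ rep_hom_eq0 (KF K F a) V -> ~ rep_hom_eq0 (KF K G a) V ->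
  exists Q, [/\ subquotient Q F, subquotient Q G & ~ rep_hom_eq0 (KF K Q a) V].
Proof.
move=> /rep_hom_neq0P[f [fV [x fx]]] /rep_hom_neq0P[f' [f'V f'0]].
have [y sum_y] := nonzero_orbit_sum K_char0 V_irr fV fx f'V f'0.
exists (goursat x y); split; [exact: goursat_left | exact: goursat_right |].
apply/rep_hom_neq0P; exists (push (y := y) f').
split; first exact: push_equivariant.
exists (fquot_proj (goursat_sub x y) a (to_linmap idfun)).
by rewrite push_id.
Qed.

(** [Hom(dsum M_ a, dsum M_ a)] contains the automorphisms as a regular
    orbit, and a function on this orbit extended by zero is equivariant:
    take [g |-> v *m V g]. *)
Lemma representable_hom : ~ rep_hom_eq0 (KF K (representable M_ a) a) V.
Proof.
have [v v0] : exists v : 'rV[K]_m, v != 0.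
  case: (V_irr) => _ V0 _; apply: contrapT => /forallNP noV.
  case/eqP: V0; apply/row_matrixP => i; rewrite row0.
  by apply/eqP/negPn/negP/noV.
apply/rep_hom_neq0P.
pose f (h : representable M_ a a) :=
  \sum_(g in aut | to_linmap (aut_linear g) == h) v *m V g.
exists f; split=> [k kA h|].
  rewrite /f (reindex_inj (mulIg k)) mulmx_suml.
  apply: eq_big => [g | g /andP[gA _]]; last first.
    by rewrite -mulmxA repr_mxM // -(groupMr _ kA).
  rewrite groupMr //; case gA: (g \in aut) => //=.
  rewrite -[RHS](inj_eq (can_inj (fmor_autK (F := representable M_ a) kA))).
  congr (_ == _); apply: linmapP => w.
  by rewrite representableE !to_linmapE !aut_linearE ?groupM // permM.
exists (to_linmap (aut_linear 1%g)).
rewrite /f (big_pred1 1%g) ?repr_mx1 ?mulmx1 //.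
move=> g; apply/andP/eqP => [[gA /eqP eg] | ->]; last by rewrite group1.
apply/permP => w; have := to_linmapE (aut_linear g) w.
by rewrite eg to_linmapE !aut_linearE ?group1.
Qed.

Lemma minimal_exists (a_gt0 : forall i, (0 < a i)%N) : exists F,
    ~ rep_hom_eq0 (KF K F a) V /\
    forall G, strict_subquotient G F -> rep_hom_eq0 (KF K G a) V.
Proof.
pose has_hom k := `[< exists2 F, ~ rep_hom_eq0 (KF K F a) V & #|F a| = k >].
have : exists k, has_hom k.
  exists #|representable M_ a a|; apply/asboolP.
  by exists (representable M_ a) => //; exact: representable_hom.
case/ex_minnP=> k /asboolP[F F0 Fk] k_min; exists F; split=> // G GF.
apply: contrapT => G0; have := strict_subquotient_card a_gt0 GF.
by rewrite ltnNge Fk k_min //; apply/asboolP; exists G.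
Qed.

Lemma minimal_unique F G :
  ~ rep_hom_eq0 (KF K F a) V ->
  (forall Q, strict_subquotient Q F -> rep_hom_eq0 (KF K Q a) V) ->
  ~ rep_hom_eq0 (KF K G a) V ->
  (forall Q, strict_subquotient Q G -> rep_hom_eq0 (KF K Q a) V) ->
  functor_iso F G.
Proof.
move=> F0 F_min G0 G_min; have [Q [QF QG Q0]] := common_subquotient F0 G0.
have iso_QF : functor_iso Q F by apply: contrapT => no; apply/Q0/F_min.
have iso_QG : functor_iso Q G by apply: contrapT => no; apply/Q0/G_min.
exact: functor_iso_trans (functor_iso_sym iso_QF) iso_QG.
Qed.
End Minimal.

Theorem theorem1
    (O : idomainType) (pi : O) (Opi : complete_dvr pi)
    (l : nat) (l_gt0 : (0 < l)%N)
    (R : finAlgType (trunc_ring Opi l_gt0))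
    (K : closedFieldType) (K_char0 : [pchar K] =i pred0)
    (n : nat) (M_ : 'I_n -> finLmodType R)
    (M_indec : forall i, indecomposable (M_ i))
    (M_noniso : forall i j, i != j -> ~ mod_iso (M_ i) (M_ j))
    (a : 'I_n -> nat) (a_gt0 : forall i, (0 < a i)%N)
    (m : nat) (V : mx_representation K (mod_aut (dsum M_ a)) m)
    (V_irr : mx_irreducible V) :
  let minimal (F : lin_functor M_) :=
    ~ rep_hom_eq0 (KF K F a) V /\
    (forall G : lin_functor M_, strict_subquotient G F ->
       rep_hom_eq0 (KF K G a) V) in
  exists F : lin_functor M_,
    minimal F /\ forall F' : lin_functor M_, minimal F' -> functor_iso F F'.
Proof.
move=> minimal; have [F F_min] := minimal_exists V_irr a_gt0.
exists F; split=> // F' [F'0 F'_min]; case: F_min => F0 F_min.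
exact: (minimal_unique K_char0 V_irr F0 F_min F'0 F'_min).
Qed.
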